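(* Let $N,\tilde M\in\mathbb{N}$ be such that $N<\tilde M<2N$. Define $M=\tilde M+N$ and $\lambda=M/N\ge 2$. Then $\mathrm{STF}(N,\tilde M)$ is a FUNTF for $\mathbb{R}^N$ if and only if $$j\lambda-\lfloor (j-1)\lambda\rfloor\ge 3\qquad\text{for all integers } j \text{ with } 1<j<\frac{N}{\gcd(N,M)}.$$
   Context: A finite collection $\{\varphi_i\}_{i=1}^{M'}\subset\mathbb{R}^N$ is a tight frame for $\mathbb{R}^N$ if there is $A>0$ with $\sum_i|\langle x,\varphi_i\rangle|^2=A\|x\|^2$ for all $x$. It is a finite unit norm tight frame (FUNTF) if moreover all $\|\varphi_i\|=1$. Spectral tetris construction $\mathrm{STF}(N,M')$ for $N,M'\in\mathbb{N}$. Put $\lambda'=M'/N$ and $K'=\{\,nN/\gcd(N,M'): n=0,1,\dots,\gcd(N,M')\,\}$. For $j=1,\dots,N$ define recursively $m_j\in\mathbb{N}_0$ and $r_j\in[0,1)$ by $$\lambda'=m_j+r_j\ \text{ if } j-1\in K',\qquad \lambda'=(2-r_{j-1})+m_j+r_j\ \text{ otherwise.}$$ If for some $j$ no such $m_j\in\mathbb{N}_0$, $r_j\in[0,1)$ exist, the construction does not work and one sets $\mathrm{STF}(N,M')=\emptyset$ (which is not a FUNTF). Otherwise put $a_j=\sqrt{r_j/2}$, $b_j=\sqrt{1-r_j/2}$, and let $\mathrm{STF}(N,M')$ be the collection of vectors (with repetition) in $\mathbb{R}^N$ consisting of $m_j$ copies of $e_j$ for each $j=1,\dots,N$, together with the two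 vectors $a_je_j+b_je_{j+1}$ and $a_je_j-b_je_{j+1}$ for each $j\in\{1,\dots,N-1\}\setminus K'$, where $e_1,\dots,e_N$ is the standard basis of $\mathbb{R}^N$. *)

(* Defs.v *)
From HB Require Import structures.
From mathcomp Require Import all_boot all_order all_algebra.
From mathcomp Require Import boolp reals.

Set Implicit Arguments.
Unset Strict Implicit.
Unset Printing Implicit Defensive.

Import Order.TTheory GRing.Theory Num.Theory.
Local Open Scope ring_scope.

Definition dot (R : realType) (N : nat) (x y : 'rV[R]_N) : R :=
  \sum_(i < N) x 0 i * y 0 i.

(* The Euclidean norm; the library norm on 'rV[R]_N is the sup norm. *)
Definition enorm (R : realType) (N : nat) (x : 'rV[R]_N) : R :=
  Num.sqrt (dot x x).

(* Finite collections with repetition are sequences of row vectors. *)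
Definition tight_frame (R : realType) (N : nat) (phi : seq 'rV[R]_N) : Prop :=
  exists2 A : R, 0 < A &
    forall x : 'rV[R]_N, \sum_(f <- phi) `|dot x f| ^+ 2 = A * enorm x ^+ 2.

Definition FUNTF (R : realType) (N : nat) (phi : seq 'rV[R]_N) : Prop :=
  tight_frame phi /\ (forall f, f \in phi -> enorm f = 1).

Definition stf_K (N M' : nat) : seq nat :=
  [seq (n * N) %/ gcdn N M' | n <- iota 0 (gcdn N M').+1]%N.

(* Indices j run over 1, ..., N; values of m and r elsewhere are irrelevant.
   In the else branch j > 1, since 0 belongs to stf_K N M'. *)
Definition stf_rec (R : realType) (N M' : nat) (m : nat -> nat) (r : nat -> R)
    : Prop :=
  forall j : nat, (1 <= j <= N)%N ->
    0 <= r j < 1 /\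
    (if (j.-1 \in stf_K N M')
     then M'%:R / N%:R = (m j)%:R + r j
     else M'%:R / N%:R = (2 - r j.-1) + (m j)%:R + r j).

(* The standard basis vector e_j, numbered from 1 as j = 1, ..., N. *)
Definition stdvec (R : realType) (N j : nat) : 'rV[R]_N :=
  \row_(i < N) (i.+1 == j)%:R.

Definition stf_vectors (R : realType) (N M' : nat)
    (m : nat -> nat) (r : nat -> R) : seq 'rV[R]_N :=
  let e := stdvec R N in
  let a j := Num.sqrt (r j / 2) in
  let b j := Num.sqrt (1 - r j / 2) in
  flatten [seq nseq (m j) (e j) | j <- iota 1 N] ++
  flatten [seq [:: a j *: e j + b j *: e j.+1; a j *: e j - b j *: e j.+1]
          | j <- iota 1 N.-1 & j \notin stf_K N M'].

(* The construction fails at some j exactly when no global solution of the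
   recursion exists, because m_j and r_j are determined by r_(j-1): see
   stf_rec_uniq, by which the choice of a solution is also immaterial. *)
Definition STF (R : realType) (N M' : nat) : seq 'rV[R]_N :=
  if pselect (exists mr : (nat -> nat) * (nat -> R), stf_rec N M' mr.1 mr.2)
    is left ex_mr
  then stf_vectors N M' (projT1 (cid ex_mr)).1 (projT1 (cid ex_mr)).2
  else [::].

Lemma nat_frac_uniq (R : realType) (m m' : nat) (r r' : R) :
  0 <= r < 1 -> 0 <= r' < 1 -> m%:R + r = m'%:R + r' -> m = m' /\ r = r'.
Proof.
have aux (k k' : nat) (s s' : R) : 0 <= s < 1 -> 0 <= s' < 1 ->
    k%:R + s = k'%:R + s' -> (k <= k')%N.
  move=> /andP[s0 _] /andP[_ s'1] eqs.
  rewrite -ltnS -(ltr_nat R) -[k'.+1%:R]natr1.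
  apply: (@le_lt_trans _ _ (k%:R + s)); first by rewrite lerDl.
  by rewrite eqs ltrD2l.
move=> hr hr' eqs.
have mm' : m = m'.
  apply/eqP; rewrite eqn_leq (aux _ _ _ _ hr hr' eqs).
  exact: aux hr' hr (esym eqs).
by split=> //; move: eqs; rewrite mm'; apply: addrI.
Qed.

Lemma stf_rec_uniq (R : realType) (N M' : nat) (m m' : nat -> nat)
    (r r' : nat -> R) :
  stf_rec N M' m r -> stf_rec N M' m' r' ->
  forall j : nat, (1 <= j <= N)%N -> m j = m' j /\ r j = r' j.
Proof.
move=> h h'; elim=> [//|j IHj] jN.
have [hr eqr] := h _ jN; have [hr' eqr'] := h' _ jN.
apply: nat_frac_uniq => //; move: eqr eqr' => /=.
case: ifPn => [_ <- <- //|jK].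
have j0 : (0 < j)%N.
  rewrite lt0n; apply: contraNneq jK => ->.
  by apply/mapP; exists 0%N; rewrite ?mem_iota ?div0n.
have [|_ ->] := IHj; first by rewrite j0 ltnW.
by move=> ->; rewrite -!addrA; do 3!move=> /addrI.
Qed.

(* Main.v *)
(** With l' = Mt / N, summing the recursion from the last index of K shows that
    r_j is the fractional part of j l', so that m_j is the jump
    floor (j l') - floor ((j-1) l'), diminished by 2 when j-1 is not in K.
    Hence the construction works iff every such jump is at least 2; it then
    gives a unit norm tight frame with bound l'.  As 1 < l' < 2, the jumps are
    periodic with period L = N / gcd(N, Mt), and the jump at L is always 2,
    which leaves the indices 1 < j < L. *)
Require Import Defs.
From HB Require Import structures.
From mathcomp Require Import all_boot all_order all_algebra.
From mathcomp Require Import boolp reals.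
From mathcomp Require Import zify ring lra.

Set Implicit Arguments.
Unset Strict Implicit.
Unset Printing Implicit Defensive.

Import Order.TTheory GRing.Theory Num.Theory.
Local Open Scope ring_scope.

(** Since g = gcd(N, M') divides N, nN/g = n(N/g); the range n <= g matches j <= N. Set membership
    thus becomes divisibility by the period L = N/g. *)
Lemma mem_stf_K (N M' j : nat) : (0 < N)%N -> (j <= N)%N ->
  (j \in stf_K N M') = (N %/ gcdn N M' %| j)%N.
Proof.
move=> N0 jN; set g := gcdn N M'.
have g0 : (0 < g)%N by rewrite gcdn_gt0 N0.
have gN : (g %| N)%N := dvdn_gcdl _ _.
have L0 : (0 < N %/ g)%N by rewrite divn_gt0 // dvdn_leq.
apply/mapP/idP => [[n _ ->]|/dvdnP[q jq]].
  by rewrite -muln_divA // dvdn_mull.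
exists q; last by rewrite -muln_divA.
by rewrite mem_iota /= add0n ltnS -(leq_pmul2r L0) -jq muln_divA // mulKn.
Qed.

Lemma natr_divn_eq (R : realType) (a N : nat) : (0 < N)%N ->
  a%:R / N%:R = (a %/ N)%:R + (a %% N)%:R / N%:R :> R.
Proof.
move=> N0; have NR : N%:R != 0 :> R by rewrite pnatr_eq0 -lt0n.
by rewrite {1}(divn_eq a N) natrD natrM mulrDl mulfK.
Qed.

Lemma natr_modn_itv (R : realType) (a N : nat) : (0 < N)%N ->
  0 <= ((a %% N)%:R / N%:R : R) < 1.
Proof.
move=> N0; rewrite divr_ge0 //= ltr_pdivrMr ?ltr0n //.
by rewrite mul1r ltr_nat ltn_mod.
Qed.

Lemma floor_natr_div (R : realType) (a N : nat) : (0 < N)%N ->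
  Num.floor (a%:R / N%:R : R) = (a %/ N)%:Z.
Proof.
move=> N0; apply: floor_def.
rewrite natr_divn_eq // intrD -!pmulrn.
by have /andP[h0 h1] := natr_modn_itv R a N0; rewrite lerDl h0 ltrD2l.
Qed.

(** N divides (N/g)M' = N(M'/g). Hence j M'/N is an integer on K, which is why restarting the
    recursion there agrees with taking fractional parts. *)
Lemma mem_stf_K_mod (N M' j : nat) : (0 < N)%N -> (j <= N)%N ->
  j \in stf_K N M' -> ((j * M') %% N = 0)%N.
Proof.
move=> N0 jN; rewrite mem_stf_K // => /dvdnP[q ->].
by rewrite -mulnA divn_mulAC ?dvdn_gcdl // -muln_divA ?dvdn_gcdr // mulnCA modnMr.
Qed.

(** Induction on j: add M'/N, as given by the recursion, to j M'/N = floor + r_j. Off K the term 2 -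
    r_j cancels r_j and leaves the integer 2; on K the fractional part is already 0. Uniqueness of
    integer and fractional parts concludes. *)
Lemma stf_rec_remainder (R : realType) (N M' : nat) (m : nat -> nat)
    (r : nat -> R) : (0 < N)%N -> stf_rec N M' m r ->
  forall j : nat, (1 <= j <= N)%N ->
    r j = ((j * M') %% N)%:R / N%:R /\
    ((j * M') %/ N = (j.-1 * M') %/ N + m j
     + (if j.-1 \in stf_K N M' then 0 else 2))%N.
Proof.
move=> N0 h; elim=> [//|j IHj] jN.
have [hr eqr] := h _ jN; rewrite /= in eqr *.
have step : (j.+1 * M')%:R / N%:R = (j * M')%:R / N%:R + M'%:R / N%:R :> R.
  by rewrite -mulrDl -natrD mulSn addnC.
have [|<- ->] //= := @nat_frac_uniq R ((j * M') %/ N + m j.+1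
    + (if j \in stf_K N M' then 0 else 2))%N ((j.+1 * M') %/ N) (r j.+1)
  (((j.+1 * M') %% N)%:R / N%:R) hr (natr_modn_itv R _ N0).
rewrite -natr_divn_eq // step [(j * M')%:R / _]natr_divn_eq //.
move: eqr; case: ifPn => jK ->.
  rewrite (mem_stf_K_mod N0 _ jK) ?mul0r; last by rewrite ltnW.
  by rewrite !natrD; ring.
have j0 : (0 < j)%N.
  by rewrite lt0n; apply: contraNneq jK => ->; rewrite mem_stf_K.
have [|<- _] := IHj; first by rewrite j0 ltnW.
by rewrite !natrD; ring.
Qed.

Lemma stf_rec_exP (R : realType) (N M' : nat) : (0 < N)%N ->
  (exists mr : (nat -> nat) * (nat -> R), stf_rec N M' mr.1 mr.2) <->
  (forall j : nat, (j < N)%N -> j \notin stf_K N M' ->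
     ((j * M') %/ N + 2 <= (j.+1 * M') %/ N)%N).
Proof.
move=> N0; split=> [[[m r] /= h] j jN jK|H].
  have [|_] := stf_rec_remainder N0 h (j := j.+1); first by rewrite jN.
  by rewrite /= (negPf jK) => ->; rewrite addnAC leq_addr.
pose c j := if j \in stf_K N M' then 0%N else 2%N.
(* The subtractions are truncated in [nat]; [le_c] below shows that nothing is lost, by hypothesis
   off K and by monotonicity of the quotient on K. *)
exists (fun j => (j * M') %/ N - (j.-1 * M') %/ N - c j.-1,
        fun j => ((j * M') %% N)%:R / N%:R)%N => /=.
case=> [//|j] /= jN; split; first exact: natr_modn_itv.
have le_c : ((j * M') %/ N + c j <= (j.+1 * M') %/ N)%N.
  rewrite /c; case: ifPn => jK; last exact: H.
  by rewrite addn0 leq_div2r // leq_mul2r leqnSn orbT.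
have step : M'%:R / N%:R = (j.+1 * M')%:R / N%:R - (j * M')%:R / N%:R :> R.
  by rewrite -mulrBl mulSn natrD addrK.
rewrite step [X in X - _]natr_divn_eq // [X in _ - X]natr_divn_eq //.
rewrite -subnDA natrB // natrD /c.
case: ifPn => jK; last by rewrite (negPf jK); ring.
by rewrite jK (mem_stf_K_mod N0 _ jK) ?mul0r; [ring | rewrite ltnW].
Qed.

Section Frame.
Variables (R : realType) (N : nat).
Implicit Types x y z : 'rV[R]_N.

Lemma dotC x y : dot x y = dot y x.
Proof. by apply: eq_bigr => i _; rewrite mulrC. Qed.

Lemma dotDr x y z : dot x (y + z) = dot x y + dot x z.
Proof. by rewrite -big_split; apply: eq_bigr => i _; rewrite mxE mulrDr. Qed.

Lemma dotZr x (a : R) y : dot x (a *: y) = a * dot x y.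
Proof. by rewrite mulr_sumr; apply: eq_bigr => i _; rewrite mxE mulrCA. Qed.

Lemma dot_stdvec x (i : 'I_N) : dot x (stdvec R N i.+1) = x 0 i.
Proof.
rewrite /dot (bigD1 i) //= mxE eqxx mulr1 big1 ?addr0 // => k ki.
by rewrite mxE eqSS (inj_eq val_inj) (negPf ki) mulr0.
Qed.

Lemma dot_stdvec2 (j k : nat) : (1 <= k <= N)%N ->
  dot (stdvec R N j) (stdvec R N k) = (k == j)%:R.
Proof. by case: k => [//|k] /= kN; rewrite (dot_stdvec _ (Ordinal kN)) mxE. Qed.

Lemma dot_self_sum x :
  dot x x = \sum_(1 <= j < N.+1) dot x (stdvec R N j) ^+ 2.
Proof.
rewrite big_add1 /= big_mkord; apply: eq_bigr => i _.
by rewrite dot_stdvec expr2.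
Qed.

Lemma enorm_sqr x : enorm x ^+ 2 = dot x x.
Proof. by rewrite sqr_sqrtr // sumr_ge0 // => i _; rewrite -expr2 sqr_ge0. Qed.

(** Covers the default value [[::]] of [STF]: testing at e_1 forces the bound A to be 0. *)
Lemma not_tight_frame_nil : (0 < N)%N -> ~ tight_frame ([::] : seq 'rV[R]_N).
Proof.
move=> N0 [A A0 /(_ (stdvec R N 1))].
rewrite big_nil enorm_sqr dot_stdvec2 // mulr1 => A_eq0.
by rewrite -A_eq0 ltxx in A0.
Qed.

(** The cross terms of each pair a_j e_j ± b_j e_(j+1) cancel, so it contributes r_j x_j^2 + (2 -
    r_j) x_(j+1)^2. Collecting the coefficient of x_j^2 gives exactly the right-hand side of the
    recursion, that is M'/N. *)
Lemma stf_vectors_FUNTF (M' : nat) (m : nat -> nat) (r : nat -> R) :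
  (0 < N)%N -> (0 < M')%N -> stf_rec N M' m r -> FUNTF (stf_vectors N M' m r).
Proof.
move=> N0 M0 h; have r_itv j : (1 <= j <= N)%N -> 0 <= r j < 1.
  by move=> /h[].
have sqrt_a j : (1 <= j <= N)%N -> Num.sqrt (r j / 2) ^+ 2 = r j / 2.
  by move=> /r_itv ?; rewrite sqr_sqrtr //; lra.
have sqrt_b j : (1 <= j <= N)%N -> Num.sqrt (1 - r j / 2) ^+ 2 = 1 - r j / 2.
  by move=> /r_itv ?; rewrite sqr_sqrtr //; lra.
split; last first.
  move=> f; rewrite /stf_vectors mem_cat => /orP[] /flatten_mapP[j].
    rewrite mem_iota add1n ltnS => jN; rewrite mem_nseq => /andP[_ /eqP ->].
    by rewrite /enorm dot_stdvec2 // eqxx sqrtr1.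
  rewrite mem_filter mem_iota => /andP[_ jN].
  have {}jN : (0 < j < N)%N by lia.
  have j1 : (1 <= j <= N)%N by lia.
  have j2 : (1 <= j.+1 <= N)%N by lia.
  (* Only s^2 is prescribed, so that s = b_j and s = -b_j are treated at once. *)
  have norm1 (s : R) : s ^+ 2 = 1 - r j / 2 ->
      enorm (Num.sqrt (r j / 2) *: stdvec R N j + s *: stdvec R N j.+1) = 1.
    move=> s2; rewrite /enorm dotDr !dotZr ![dot (_ + _) _]dotC !dotDr !dotZr.
    rewrite !dot_stdvec2 //.
    rewrite !eqxx (gtn_eqF (ltnSn j)) (ltn_eqF (ltnSn j)).
    rewrite !mulr0 !mulr1 addr0 add0r -!expr2 s2 sqrt_a //.
    by rewrite addrC subrK sqrtr1.
  rewrite !inE => /orP[] /eqP ->; first exact/norm1/sqrt_b.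
  by rewrite -scaleNr; apply: norm1; rewrite sqrrN sqrt_b.
exists (M'%:R / N%:R); first by rewrite divr_gt0 ?ltr0n.
move=> x; rewrite enorm_sqr dot_self_sum /stf_vectors big_cat /=.
set X := fun j => dot x (stdvec R N j).
rewrite !big_flatten !big_map big_filter /=.
pose c j : R := (j \notin stf_K N M')%:R.
have -> : \sum_(j <- iota 1 N) \sum_(f <- nseq (m j) (stdvec R N j))
    `|dot x f| ^+ 2 = \sum_(1 <= j < N.+1) (m j)%:R * X j ^+ 2.
  rewrite /index_iota subn1; apply: eq_bigr => j _.
  by rewrite big_nseq iter_addr_0 real_normK ?num_real // mulr_natl.
rewrite -(subn1 N) -/(index_iota 1 N) [S in _ + S]big_mkcond /=.
under [S in _ + S = _]eq_big_nat => j jN.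
  rewrite (_ : (if _ then _ else _) =
    c j * r j * X j ^+ 2 + c j * (2 - r j) * X j.+1 ^+ 2).
    over.
  rewrite /c; case: ifP => _; last by rewrite !mul0r addr0.
  have j1 : (1 <= j <= N)%N by lia.
  rewrite !big_cons big_nil -scaleNr !dotDr !dotZr !real_normK ?num_real //.
  rewrite -/(X j) -/(X j.+1).
  have := sqrt_a _ j1; have := sqrt_b _ j1.
  move: (Num.sqrt _) => b; move: (Num.sqrt _) => a b2 a2.
  rewrite (_ : _ + _ = 2 * a ^+ 2 * X j ^+ 2 + 2 * b ^+ 2 * X j.+1 ^+ 2).
    by rewrite a2 b2 !mul1r; field.
  by ring.
(* Both sums extend to 1..N, the second after an index shift: the added terms vanish because N and 0
   lie in K. *)
have NK : N \in stf_K N M' by rewrite mem_stf_K // dvdn_div ?dvdn_gcdl.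
rewrite big_split /= mulr_sumr.
have -> : \sum_(1 <= j < N) c j * r j * X j ^+ 2 =
    \sum_(1 <= j < N.+1) c j * r j * X j ^+ 2.
  by rewrite [RHS]big_nat_recr //= /c NK !mul0r addr0.
have -> : \sum_(1 <= j < N) c j * (2 - r j) * X j.+1 ^+ 2 =
    \sum_(1 <= j < N.+1) c j.-1 * (2 - r j.-1) * X j ^+ 2.
  by rewrite [RHS]big_nat_recl //= [in RHS]/c mem_stf_K // dvdn0 !mul0r add0r.
rewrite -!big_split /=; apply: eq_big_nat => j jN.
have [_ hj] := h _ jN.
(* On K, where [c j] is 0, the remainder r_j vanishes as well. *)
have cr : c j * r j = r j.
  rewrite /c; case: (boolP (j \in _)) => jK; last by rewrite mul1r.
  have [-> _] := stf_rec_remainder N0 h jN.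
  by rewrite (mem_stf_K_mod N0 _ jK) ?mul0r ?mulr0 //; lia.
rewrite -/(X j) cr /c; move: hj.
by case: (_ \in _) => ->; rewrite /= ?mul0r ?mul1r; ring.
Qed.

End Frame.

(** In lowest terms M'/N = p/L, so the jump from j to j+1 depends only on j mod L. Residue 0 is
    excluded by K, and residue L - 1 always satisfies the bound. *)
Lemma jump_reduce (N M' : nat) : (N < M')%N -> (M' < 2 * N)%N ->
  (forall j : nat, (j < N)%N -> j \notin stf_K N M' ->
     ((j * M') %/ N + 2 <= (j.+1 * M') %/ N)%N) <->
  (forall j : nat, (0 < j)%N -> (j.+1 < N %/ gcdn N M')%N ->
     ((j * M') %/ N + 2 <= (j.+1 * M') %/ N)%N).
Proof.
move=> hN hM; have N0 : (0 < N)%N by lia.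
pose g := gcdn N M'; pose L := (N %/ g)%N; pose p := (M' %/ g)%N.
have g0 : (0 < g)%N by rewrite gcdn_gt0 N0.
have NL : N = (L * g)%N by rewrite divnK ?dvdn_gcdl.
have Mp : M' = (p * g)%N by rewrite divnK ?dvdn_gcdr.
have divE j : ((j * M') %/ N = (j * p) %/ L)%N.
  by rewrite NL Mp mulnA divnMr.
have [Lp pL L0] : [/\ (L < p)%N, (p < 2 * L)%N & (0 < L)%N] by split; nia.
rewrite -/g -/L; split=> H j.
  move=> j0 jL; apply: H; first by nia.
  rewrite mem_stf_K //; last by nia.
  by rewrite -/g -/L gtnNdvd // ltnW.
move=> jN; rewrite mem_stf_K ?(ltnW jN) // -/g -/L => jK.
have i0 : (0 < j %% L)%N by rewrite lt0n.
have shift k : ((j %/ L * L + k) * p %/ L = j %/ L * p + k * p %/ L)%N.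
  by rewrite mulnDl mulnAC divnMDl.
rewrite !divE (divn_eq j L) -addnS !shift -addnA leq_add2l.
have := ltn_pmod j L0; rewrite leq_eqVlt => /orP[/eqP iL|iL]; last first.
  by rewrite -!divE; apply: H.
(* Last residue: the next quotient is p, and L < p gives (L - 1)p < (p - 1)L, so the current one is
   at most p - 2. *)
rewrite iL mulKn //.
suff : (j %% L * p %/ L < p - 1)%N by lia.
rewrite ltn_divLR // -{2}iL mulnS mulnBl mul1n [(p * _)%N]mulnC.
suff : (j %% L <= j %% L * p)%N by lia.
by rewrite leq_pmulr //; lia.
Qed.

Theorem corollary3p10 (R : realType) (N Mt : nat)
    (hN : (N < Mt)%N) (hMt : (Mt < 2 * N)%N) :
  let M := (Mt + N)%N in
  let lambda : R := M%:R / N%:R in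
  FUNTF (STF R N Mt) <->
  (forall j : nat, (1 < j)%N -> (j < N %/ gcdn N M)%N ->
    3 <= j%:R * lambda - (Num.floor ((j%:R - 1) * lambda))%:~R).
Proof.
move=> M lambda; have N0 : (0 < N)%N by lia.
have M0 : (0 < Mt)%N by lia.
have FUNTF_iff : FUNTF (STF R N Mt) <->
    exists mr : (nat -> nat) * (nat -> R), stf_rec N Mt mr.1 mr.2.
  rewrite /STF; case: pselect => [ex_mr|no_mr].
    by split=> // _; apply: stf_vectors_FUNTF => //; case: (cid ex_mr).
  by split=> // -[/not_tight_frame_nil].
(* As lambda = Mt/N + 1, the left side equals (j+1)Mt/N + 1 - floor(j Mt/N); comparing a real with
   an integer is then comparing its floor. The index is shifted by one. *)
have condE j : (3 <= j.+1%:R * lambda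
      - (Num.floor ((j.+1%:R - 1) * lambda))%:~R)
    = ((j * Mt) %/ N + 2 <= (j.+1 * Mt) %/ N)%N.
  have -> : j.+1%:R - 1 = j%:R :> R by rewrite -natr1 addrK.
  rewrite !mulrA -!natrM floor_natr_div // -pmulrn.
  rewrite lerBrDr -natrD ler_pdivlMr ?ltr0n // -natrM ler_nat.
  rewrite mulnDr divnDr ?dvdn_mull // mulnK // leq_divRL // mulnDr.
  by apply/idP/idP; nia.
apply: (iff_trans FUNTF_iff); apply: (iff_trans (stf_rec_exP R Mt N0)).
apply: (iff_trans (jump_reduce hN hMt)).
(* gcd(N, Mt + N) = gcd(N, Mt), so both conditions have the same range of indices. *)
rewrite /M gcdnDr; split=> H [|j] // j1 jL; first by rewrite condE; apply: H.
by rewrite -condE; apply: H.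
Qed.
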